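(* Let $n\geq 1$ and suppose $w$ is a positive word of length at least $3$ in the generators $x_0,\ldots,x_{n-1}$. Then $G_n(w)^{\mathrm{ab}}\not\cong\mathbb{Z}$.
   Context: For an element $w=w(x_0,\ldots,x_{n-1})$ of the free group $F(x_0,\ldots,x_{n-1})$, the cyclically presented group $G_n(w)$ is the group with presentation $\langle x_0,\ldots,x_{n-1}\mid w(x_i,x_{i+1},\ldots,x_{i+n-1})\ (0\leq i<n)\rangle$, subscripts taken modulo $n$. A word $w$ is positive if it does not involve the inverse of any generator. $G^{\mathrm{ab}}$ denotes the abelianisation of $G$. *)

(* Defs.v *)
From HB Require Import structures.
From mathcomp Require Import all_boot all_order ssralg ssrnum ssrint.
From mathcomp Require Import boolp classical_sets.

Set Implicit Arguments.
Unset Strict Implicit.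
Unset Printing Implicit Defensive.

Local Open Scope group_scope.

(* [(x, false)] is the letter x and [(x, true)] is the letter x^-1. *)
Notation signed_letter T := (T * bool)%type (only parsing).

Section ReducedWords.
Variable T : choiceType.

Local Notation letter := (signed_letter T) (only parsing).

Definition letter_inv (l : letter) : letter := (l.1, ~~ l.2).

Definition cancelling (l m : letter) : bool := m == letter_inv l.

Definition reduced (s : seq letter) : bool :=
  sorted (fun l m => ~~ cancelling l m) s.

Definition reduced_cons (l : letter) (s : seq letter) : seq letter :=
  if s is m :: s' then if cancelling l m then s' else l :: s else [:: l].

Definition reduce (s : seq letter) : seq letter :=
  foldr reduced_cons [::] s.

Definition word_inv (s : seq letter) : seq letter := rev (map letter_inv s).

Lemma letter_invK : involutive letter_inv.
Proof. by case=> x b; rewrite /letter_inv /= negbK. Qed.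

Lemma cancelling_sym l m : cancelling l m = cancelling m l.
Proof. by rewrite /cancelling -(can2_eq letter_invK letter_invK) eq_sym. Qed.

Lemma reduced_behead l s : reduced (l :: s) -> reduced s.
Proof. by case: s => //= m s /andP[]. Qed.

Lemma reduced_cons_reduced l s : reduced s -> reduced (reduced_cons l s).
Proof.
case: s => [|m s] //= hs; case: ifP => [_|hc]; first exact: reduced_behead hs.
by rewrite /= hc.
Qed.

Lemma reduce_reduced s : reduced (reduce s).
Proof. by elim: s => //= l s; apply: reduced_cons_reduced. Qed.

Lemma reduce_id s : reduced s -> reduce s = s.
Proof.
elim: s => //= l s IHs hs; rewrite IHs ?(reduced_behead hs) //.
by case: s hs {IHs} => //= m s /andP[/negbTE ->].
Qed.

Lemma reduced_consK l s :
  reduced s -> reduced_cons (letter_inv l) (reduced_cons l s) = s.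
Proof.
have ll : cancelling (letter_inv l) l by rewrite cancelling_sym /cancelling.
case: s => [|m s] /=; first by rewrite ll.
case: ifP => [/eqP ->|_ _] /=; last by rewrite ll.
by case: s => [|k s] //= /andP[/negbTE ->].
Qed.

Lemma foldr_reduced s t :
  reduced t -> reduced (foldr reduced_cons t s).
Proof. by move=> ht; elim: s => //= l s; apply: reduced_cons_reduced. Qed.

Lemma reduce_cat s t : reduce (s ++ t) = foldr reduced_cons (reduce t) s.
Proof. by rewrite /reduce foldr_cat. Qed.

Lemma foldr_reduced_cons l s t : reduced t ->
  foldr reduced_cons t (reduced_cons l s) =
  reduced_cons l (foldr reduced_cons t s).
Proof.
case: s => [|m s] //= ht; case: ifP => //= /eqP ->.
by rewrite -{1}[l]letter_invK reduced_consK ?foldr_reduced.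
Qed.

Lemma foldr_reduce s t : reduced t ->
  foldr reduced_cons t (reduce s) = foldr reduced_cons t s.
Proof. by move=> ht; elim: s => //= l s IHs; rewrite foldr_reduced_cons ?IHs. Qed.

Lemma reduce_catl s t : reduce (reduce s ++ t) = reduce (s ++ t).
Proof. by rewrite !reduce_cat foldr_reduce ?reduce_reduced. Qed.

Lemma reduce_catr s t : reduce (s ++ reduce t) = reduce (s ++ t).
Proof. by rewrite !reduce_cat (reduce_id (reduce_reduced t)). Qed.

Lemma word_invK : involutive word_inv.
Proof.
by move=> s; rewrite /word_inv map_rev revK -map_comp map_id_in // => l _; exact: letter_invK.
Qed.

Lemma reduce_catVw s : reduce (word_inv s ++ s) = [::].
Proof.
elim: s => //= l s IHs; rewrite /word_inv /= rev_cons -cats1 -catA.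
rewrite reduce_cat /= -/(reduce s) reduced_consK ?reduce_reduced //.
by rewrite -reduce_cat.
Qed.

Lemma reduce_catwV s : reduce (s ++ word_inv s) = [::].
Proof. by rewrite -{1}[s]word_invK reduce_catVw. Qed.

Record free_group : Type :=
  FreeGroup { fg_word :> seq letter; _ : reduced fg_word }.

HB.instance Definition _ := [isSub for fg_word].
HB.instance Definition _ := [Choice of free_group by <:].

Definition fg_of_word (s : seq letter) : free_group :=
  FreeGroup (reduce_reduced s).

Definition fg_one : free_group := fg_of_word [::].
Definition fg_mul (u v : free_group) : free_group := fg_of_word (u ++ v).
Definition fg_inv (u : free_group) : free_group := fg_of_word (word_inv u).

Lemma fg_mulA : associative fg_mul.
Proof.
by move=> u v w; apply: val_inj; rewrite /= reduce_catl reduce_catr catA.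
Qed.

Lemma fg_wordK (u : free_group) : reduce u = u.
Proof. by case: u => s hs; rewrite /= reduce_id. Qed.

Lemma fg_mul1 : left_id fg_one fg_mul.
Proof. by move=> u; apply: val_inj; rewrite /= fg_wordK. Qed.

Lemma fg_mulr1 : right_id fg_one fg_mul.
Proof. by move=> u; apply: val_inj; rewrite /= cats0 fg_wordK. Qed.

Lemma fg_mulV : left_inverse fg_one fg_inv fg_mul.
Proof. by move=> u; apply: val_inj; rewrite /= reduce_catl reduce_catVw. Qed.

Lemma fg_mulrV : right_inverse fg_one fg_inv fg_mul.
Proof. by move=> u; apply: val_inj; rewrite /= reduce_catr reduce_catwV. Qed.

HB.instance Definition _ := isGroup.Build free_group
  fg_mulA fg_mul1 fg_mulr1 fg_mulV fg_mulrV.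

Definition fg_gen (x : T) : free_group := fg_of_word [:: (x, false)].

Definition positive (w : free_group) : bool :=
  all (fun l : letter => ~~ l.2) (fg_word w).

End ReducedWords.

Section Substitution.
Variables (T : choiceType) (G : groupType) (f : T -> G).

Definition letter_subst (l : signed_letter T) : G := if l.2 then (f l.1)^-1 else f l.1.

Definition fg_lift (w : free_group T) : G :=
  \prod_(l <- fg_word w) letter_subst l.

Lemma letter_substV l : letter_subst (letter_inv l) = (letter_subst l)^-1.
Proof. by case: l => x [] //=; rewrite /letter_subst /= invgK. Qed.

Lemma prod_reduced_cons l s :
  \prod_(m <- reduced_cons l s) letter_subst m =
  letter_subst l * \prod_(m <- s) letter_subst m.
Proof.
case: s => [|m s] /=; first by rewrite big_cons.
case: ifP => [/eqP ->|_]; last by rewrite big_cons.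
by rewrite [X in _ = _ * X]big_cons letter_substV mulgA mulgV mul1g.
Qed.

Lemma prod_reduce s :
  \prod_(m <- reduce s) letter_subst m = \prod_(m <- s) letter_subst m.
Proof.
by elim: s => //= l s IHs; rewrite prod_reduced_cons IHs big_cons.
Qed.

Lemma fg_liftM : {morph fg_lift : u v / u * v}.
Proof. by move=> u v; rewrite /fg_lift /= prod_reduce big_cat. Qed.

Lemma fg_lift1 : fg_lift 1 = 1.
Proof. by rewrite /fg_lift big_nil. Qed.

Lemma fg_lift_gen x : fg_lift (fg_gen x) = f x.
Proof. by rewrite /fg_lift /= big_seq1. Qed.

End Substitution.

Section NormalSubgroups.
Variable G : groupType.

Definition is_subgroup (H : set G) : Prop :=
  [/\ H 1, forall x y, H x -> H y -> H (x * y) & forall x, H x -> H x^-1].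

Definition is_normal (H : set G) : Prop :=
  is_subgroup H /\ forall x y, H x -> H (x ^ y).

Record normal_subgroup : Type :=
  NormalSubgroup { ns_set : set G; ns_normal : is_normal ns_set }.

Lemma normal_closure_normal (S : set G) : is_normal (smallest is_normal S).
Proof.
split; last by move=> x y hx N hN; apply: hN.1.2; apply: hx.
split.
- by move=> N [[[]]].
- by move=> x y hx hy N hN; case: (hN.1.1) => _ + _; apply; [apply: hx|apply: hy].
- by move=> x hx N hN; case: (hN.1.1) => _ _; apply; apply: hx.
Qed.

Definition normal_closure (S : set G) : normal_subgroup :=
  NormalSubgroup (normal_closure_normal S).

Definition commutators : set G := [set z | exists x y : G, z = [~ x, y]].

Lemma derived_normal : is_normal (smallest is_subgroup commutators).
Proof.
have hsub : is_subgroup (smallest is_subgroup commutators).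
  split.
  - by move=> N [[]].
  - by move=> x y hx hy N hN; case: (hN.1) => _ + _; apply; [apply: hx|apply: hy].
  - by move=> x hx N hN; case: (hN.1) => _ _; apply; apply: hx.
split=> // x y hx; have -> : x ^ y = x * [~ x, y] by rewrite commgEl mulVKg.
case: hsub => _ + _; apply=> //.
by move=> N [_]; apply; exists x, y.
Qed.

Definition derived_subgroup : normal_subgroup := NormalSubgroup derived_normal.

End NormalSubgroups.

Section QuotientGroup.
Variables (G : groupType) (N : normal_subgroup G).

Definition coset_rel (x y : G) : bool := `[< ns_set N (x^-1 * y) >].

Lemma coset_rel_refl : reflexive coset_rel.
Proof. by move=> x; apply/asboolP; rewrite mulVg; case: (ns_normal N) => -[]. Qed.

Lemma coset_rel_sym : symmetric coset_rel.
Proof.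
have h x y : coset_rel x y -> coset_rel y x.
  move=> /asboolP hxy; apply/asboolP; case: (ns_normal N) => -[_ _ /(_ _ hxy)].
  by rewrite invgM invgK.
by move=> x y; apply/idP/idP; apply: h.
Qed.

Lemma coset_rel_trans : transitive coset_rel.
Proof.
move=> y x z /asboolP hxy /asboolP hyz; apply/asboolP.
case: (ns_normal N) => -[_ /(_ _ _ hxy hyz) + _ _].
by rewrite mulgA mulgK.
Qed.

Canonical coset_equiv :=
  EquivRel coset_rel coset_rel_refl coset_rel_sym coset_rel_trans.

Definition quotient_group : Type := {eq_quot coset_equiv}%qT.

HB.instance Definition _ := Choice.on quotient_group.
HB.instance Definition _ := Quotient.on quotient_group.
HB.instance Definition _ := EqQuotient.on quotient_group.

Definition quo_class (x : G) : quotient_group := (\pi_quotient_group x)%qT.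

Lemma quo_classP x y : quo_class x = quo_class y <-> ns_set N (x^-1 * y).
Proof.
split=> [/eqquotP/asboolP //|hxy].
by apply/eqquotP/asboolP.
Qed.

Lemma coset_repr x : ns_set N (x^-1 * repr (quo_class x)).
Proof. by apply/quo_classP; rewrite /quo_class reprK. Qed.

Definition quo_one : quotient_group := quo_class 1.
Definition quo_mul (a b : quotient_group) : quotient_group :=
  quo_class (repr a * repr b).
Definition quo_inv (a : quotient_group) : quotient_group :=
  quo_class (repr a)^-1.

Lemma quo_mulE x y : quo_mul (quo_class x) (quo_class y) = quo_class (x * y).
Proof.
apply/esym/quo_classP; case: (ns_normal N) => -[_ hM _] hJ.
have := hM _ _ (hJ _ y (coset_repr x)) (coset_repr y).
by rewrite conjgE invgM !mulgA mulgK.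
Qed.

Lemma quo_invE x : quo_inv (quo_class x) = quo_class x^-1.
Proof.
apply/esym/quo_classP; case: (ns_normal N) => -[_ _ hV] hJ.
have := hJ _ x^-1 (hV _ (coset_repr x)).
by rewrite conjgE invgM !invgK mulgK.
Qed.

Lemma quo_classK a : exists x, a = quo_class x.
Proof. by exists (repr a); rewrite /quo_class reprK. Qed.

Lemma quo_mulA : associative quo_mul.
Proof.
move=> a b c; have [x ->] := quo_classK a; have [y ->] := quo_classK b.
by have [z ->] := quo_classK c; rewrite !quo_mulE mulgA.
Qed.

Lemma quo_mul1 : left_id quo_one quo_mul.
Proof. by move=> a; have [x ->] := quo_classK a; rewrite quo_mulE mul1g. Qed.

Lemma quo_mulr1 : right_id quo_one quo_mul.
Proof. by move=> a; have [x ->] := quo_classK a; rewrite quo_mulE mulg1. Qed.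

Lemma quo_mulV : left_inverse quo_one quo_inv quo_mul.
Proof.
by move=> a; have [x ->] := quo_classK a; rewrite quo_invE quo_mulE mulVg.
Qed.

Lemma quo_mulrV : right_inverse quo_one quo_inv quo_mul.
Proof.
by move=> a; have [x ->] := quo_classK a; rewrite quo_invE quo_mulE mulgV.
Qed.

HB.instance Definition _ := isGroup.Build quotient_group
  quo_mulA quo_mul1 quo_mulr1 quo_mulV quo_mulrV.

Lemma quo_classM : {morph quo_class : x y / x * y}.
Proof. by move=> x y; rewrite -quo_mulE. Qed.

End QuotientGroup.

Definition presented_group (T : choiceType) (R : set (free_group T)) : groupType :=
  quotient_group (normal_closure R).

Definition abelianisation (G : groupType) : groupType :=
  quotient_group (derived_subgroup G).

Section CyclicallyPresented.
Variable n : nat.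

Definition addmod (i j : 'I_n) : 'I_n :=
  Ordinal (ltn_pmod (i + j) (leq_ltn_trans (leq0n i) (ltn_ord i))).

(* w(x_i, x_{i+1}, ..., x_{i+n-1}), subscripts modulo n *)
Definition shifted_word (i : 'I_n) (w : free_group 'I_n) : free_group 'I_n :=
  fg_lift (fun j => fg_gen (addmod i j)) w.

Definition cyclically_presented_group (w : free_group 'I_n) : groupType :=
  presented_group (range (shifted_word^~ w)).

End CyclicallyPresented.

Definition isomorphic_to_Z (G : groupType) : Prop :=
  exists f : G -> int, {morph f : x y / x * y >-> (x + y)%R} /\ bijective f.

(* Main.v *)
(* The abelianisation of G_n(w) is A = Z[t]/(t^n - 1, f), where t shifts the
   generators and f(1) is the length L of w.  If A is isomorphic to Z then t acts
   on A as a unit c = 1 or -1.  If c = 1, the relator gives L x_0 = 0, although x_0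
   is non-zero in torsion-free A.  If c = -1, then x_0 + x_1 = 0 in A; but all
   relators have length L, so sending each generator to 1 is a homomorphism from
   A to Z/L, whence L divides 2. *)
From HB Require Import structures.
Require Import Defs.
From mathcomp Require Import all_boot.
From mathcomp Require Import all_algebra boolp classical_sets.

Set Implicit Arguments.
Unset Strict Implicit.
Unset Printing Implicit Defensive.

Local Open Scope group_scope.

(** * Morphisms out of quotients and free groups *)

Section Morphisms.
Variables (G H : groupType) (f : G -> H).
Hypothesis fM : {morph f : x y / x * y}.

Lemma group_morph1 : f 1 = 1.
Proof. by apply: (mulgI (f 1)); rewrite -fM !mulg1. Qed.

Lemma group_morphV x : f x^-1 = (f x)^-1.
Proof. by apply: (mulgI (f x)); rewrite -fM !mulgV group_morph1. Qed.

Lemma kernel_normal : is_normal [set x | f x = 1]%classic.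
Proof.
split; first split => [|x y /= fx fy|x /= fx]; first exact: group_morph1.
- by rewrite fM fx fy mulg1.
- by rewrite group_morphV fx invg1.
- by move=> x y /= fx; rewrite conjgE !fM fx mul1g -fM mulVg group_morph1.
Qed.

(** An element and the chosen representative of its class differ by an element of [N], which [f]
    kills, so [g] can evaluate [f] at representatives. *)
Lemma quo_lift (N : normal_subgroup G) : (forall u, ns_set N u -> f u = 1) ->
  exists2 g : quotient_group N -> H,
    {morph g : a b / a * b} & forall x, g (quo_class N x) = f x.
Proof.
move=> fN; pose g (a : quotient_group N) := f (repr a).
have gE x : g (quo_class N x) = f x.
  have := fN _ (coset_repr N x); rewrite /= fM group_morphV => e.
  by apply: (mulgI (f x)^-1); rewrite e mulVg.
exists g => // a b; have [x ->] := quo_classK a; have [y ->] := quo_classK b.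
by rewrite -quo_classM !gE fM.
Qed.

Lemma morph_fg_lift (T : choiceType) (b : T -> G) (w : free_group T) :
  f (fg_lift b w) = fg_lift (f \o b) w.
Proof.
rewrite /fg_lift; elim: (fg_word w) => [|l s IH].
  by rewrite !big_nil group_morph1.
by rewrite !big_cons fM IH /letter_subst; case: l.2; rewrite ?group_morphV.
Qed.

End Morphisms.

Lemma fg_lift_fg_gen (T : choiceType) (w : free_group T) :
  fg_lift (@fg_gen T) w = w.
Proof.
case: w => s hs; apply: val_inj; rewrite /fg_lift /= -[RHS](reduce_id hs).
elim: s {hs} => [|[x b] s IH]; first by rewrite big_nil.
rewrite big_cons /= -[reduced_cons _ _]/(reduce ((x, b) :: s)).
rewrite reduce_cat IH (reduce_id (reduce_reduced s)) -reduce_cat.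
by case: b; rewrite /letter_subst.
Qed.

(** * Universal property of the abelianised presentation *)

Section PresentedAbelianisation.
Variables (T : choiceType) (R : set (free_group T)).

Definition ab_class (u : free_group T) : abelianisation (presented_group R) :=
  quo_class _ (quo_class _ u : presented_group R).

Definition ab_gen (x : T) := ab_class (fg_gen x).

Lemma ab_classM : {morph ab_class : u v / u * v}.
Proof. by move=> u v; rewrite /ab_class !quo_classM. Qed.

Lemma ab_class_relator r : R r -> ab_class r = 1.
Proof.
move=> Rr; have hr : quo_class (normal_closure R) r = 1.
  apply/esym/quo_classP; rewrite invg1 mul1g => N [_]; exact.
by rewrite /ab_class hr.
Qed.

Lemma morph_ab_relator (H : groupType)
    (g : abelianisation (presented_group R) -> H) r :
  {morph g : a b / a * b} -> R r -> fg_lift (g \o ab_gen) r = 1.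
Proof.
move=> gM Rr; have gcM : {morph g \o ab_class : u v / u * v}.
  by move=> u v; rewrite /= ab_classM gM.
have := morph_fg_lift gcM (@fg_gen T) r; rewrite fg_lift_fg_gen /=.
by rewrite ab_class_relator // group_morph1.
Qed.

Lemma ab_lift (H : groupType) (a : T -> H) : (forall y z : H, y * z = z * y) ->
  (forall r, R r -> fg_lift a r = 1) ->
  exists2 g : abelianisation (presented_group R) -> H,
    {morph g : x y / x * y} & forall x, g (ab_gen x) = a x.
Proof.
move=> Hc aR; have [] := @quo_lift _ _ _ (fg_liftM a) (normal_closure R).
  (* The normal closure here, and the derived subgroup below, are smallest sets of their kind, so it
     is enough to compare each with the kernel of the map built so far. *)
  by move=> u /(_ [set v | fg_lift a v = 1]%classic); apply; split;
    [exact: kernel_normal (fg_liftM a)|exact: aR].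
move=> g1 g1M g1E; have [] := @quo_lift _ _ _ g1M (derived_subgroup _).
  move=> u /(_ [set v | g1 v = 1]%classic); apply; split.
    exact: (kernel_normal g1M).1.
  move=> _ [x [y ->]] /=; rewrite commgEl conjgE !g1M !(group_morphV g1M).
  by rewrite [g1 x * _]Hc mulKg mulVg.
by move=> g gM gE; exists g => // x; rewrite gE g1E fg_lift_gen.
Qed.

End PresentedAbelianisation.

(* Turns the additive group of V into a groupType, a possible target of fg_lift. *)
Definition multiplicative (V : Type) : Type := V.

Section Multiplicative.
Variable V : zmodType.

HB.instance Definition _ := Choice.copy (multiplicative V) V.
HB.instance Definition _ := isGroup.Build (multiplicative V)
  (@GRing.addrA V) (@GRing.add0r V) (@GRing.addr0 V)
  (@GRing.addNr V) (@GRing.addrN V).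

Lemma fg_lift_positive (T : choiceType) (a : T -> V) (w : free_group T) :
  positive w ->
  fg_lift (a : T -> multiplicative V) w = (\sum_(l <- fg_word w) a l.1)%R.
Proof.
rewrite /positive /fg_lift; elim: (fg_word w) => [|l s IH] /=.
  by rewrite !big_nil.
by case/andP=> /negbTE hl hs; rewrite !big_cons IH // /letter_subst hl.
Qed.

End Multiplicative.

Lemma int_morphE (f : int -> int) :
  {morph f : x y / (x + y)%R} -> forall m, f m = (m * f 1)%R.
Proof.
move=> fD; have f0 : f 0%R = 0%R.
  by apply: (@GRing.addrI _ (f 0%R)); rewrite -fD !GRing.addr0.
have fN m : f (- m)%R = (- f m)%R.
  by apply: (@GRing.addrI _ (f m)); rewrite -fD !GRing.addrN f0.
have fn (k : nat) : f k = (k%:Z * f 1)%R.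
  elim: k => [|k IH]; first by rewrite f0 GRing.mul0r.
  by rewrite intS fD IH GRing.mulrDl GRing.mul1r.
by case=> k; rewrite ?NegzE ?fN fn // GRing.mulNr.
Qed.

(** * Cyclic symmetry and maps from [A] to additive groups *)

Section CyclicPresentation.
Variables (n : nat) (w : free_group 'I_n).
Hypothesis wpos : positive w.

Local Notation A := (abelianisation (cyclically_presented_group w)).
Local Notation gen := (ab_gen (range ((@shifted_word n)^~ w))).

(** This is why shifting every generator carries the relator with offset [i] to the one with offset
    [ordS i]. *)
Lemma ordS_addmod (i j : 'I_n) : ordS (addmod i j) = addmod (ordS i) j.
Proof. by apply: val_inj; rewrite /= -addn1 !modnDml addn1 addSn. Qed.

Lemma val_iter_ordS k (i : 'I_n) : val (iter k (@ordS n) i) = (i + k) %% n.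
Proof.
elim: k => [|k IH] /=; first by rewrite addn0 modn_small.
by rewrite IH -addn1 modnDml addn1 addnS.
Qed.

Lemma fg_lift_shifted (V : zmodType) (a : 'I_n -> V) i :
  fg_lift (a : _ -> multiplicative V) (shifted_word i w) =
  (\sum_(l <- fg_word w) a (addmod i l.1))%R.
Proof.
rewrite (morph_fg_lift (fg_liftM _)).
rewrite -(fg_lift_positive (fun j => a (addmod i j)) wpos).
by congr (fg_lift _ w); apply/funext => j /=; rewrite fg_lift_gen.
Qed.

Lemma cyclic_ab_relation (V : zmodType) (g : A -> V) i :
  {morph g : a b / a * b >-> (a + b)%R} ->
  (\sum_(l <- fg_word w) g (gen (addmod i l.1)) = 0)%R.
Proof.
move=> gM; rewrite -(fg_lift_shifted (g \o gen)).
by apply: (morph_ab_relator (g := g : A -> multiplicative V)) => //; exists i.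
Qed.

Lemma cyclic_ab_lift (V : zmodType) (a : 'I_n -> V) :
  (forall i, \sum_(l <- fg_word w) a (addmod i l.1) = 0)%R ->
  exists2 g : A -> V,
    {morph g : a b / a * b >-> (a + b)%R} & forall i, g (gen i) = a i.
Proof.
move=> ha; apply: (@ab_lift _ _ (multiplicative V)).
  exact: GRing.addrC.
by move=> _ [i _ <-]; rewrite fg_lift_shifted.
Qed.

(** All relators are positive with [size w] letters, so once every generator goes to 1 each relator
    sums to [size w], that is, to zero. The bound ensures that ['Z_(size w)] really is the ring of
    integers modulo [size w]. *)
Lemma cyclic_ab_length : 1 < size w ->
  exists2 g : A -> 'Z_(size w),
    {morph g : a b / a * b >-> (a + b)%R} & forall i, g (gen i) = 1%R.
Proof.
move=> w1; apply: (@cyclic_ab_lift 'Z_(size w) (fun=> 1%R)) => i.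
by rewrite big_const_seq count_predT GRing.iter_addr_0 pchar_Zp.
Qed.

(** The shift respects the set of relators, so it induces an endomorphism of [A]. Transported along
    [f] it is an additive map on the integers, hence multiplication by its value at 1, which is
    [c]. *)
Lemma cyclic_ab_shift (f : A -> int) :
  {morph f : a b / a * b >-> (a + b)%R} -> bijective f ->
  exists c : int, forall i, f (gen (ordS i)) = (f (gen i) * c)%R.
Proof.
move=> fM [f' fK f'K].
have [] := @cyclic_ab_lift _ (fun i => f (gen (ordS i))) => [i|g gM gE].
  under eq_bigr => l _ do rewrite ordS_addmod; exact: cyclic_ab_relation.
exists (g (f' 1%R)) => i; rewrite -gE -{1}[gen i]fK.
apply: (int_morphE (f := g \o f')) => a b /=; rewrite -gM; congr g.
by apply: (can_inj fK); rewrite fM !f'K.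
Qed.

End CyclicPresentation.

Theorem corollary6p3 (n : nat) (hn : 1 <= n) (w : free_group 'I_n)
    (hpos : positive w) (hlen : 3 <= size w) :
  ~ isomorphic_to_Z (abelianisation (cyclically_presented_group w)).
Proof.
move=> [f [fM fbij]]; have [c fS] := cyclic_ab_shift hpos fM fbij.
have w1 : 1 < size w by apply: ltn_trans hlen.
have [g gM gx] := cyclic_ab_length hpos w1.
have f1 : f 1 = 0%R.
  by apply: (@GRing.addrI _ (f 1)); rewrite -fM mulg1 GRing.addr0.
have g1 : g 1 = 0%R.
  by apply: (@GRing.addrI _ (g 1)); rewrite -gM mulg1 GRing.addr0.
pose x := ab_gen (range ((@shifted_word n)^~ w)).
pose o := Ordinal hn.
(* [g] sends [x i] to 1, which is non-zero modulo [size w], so [x i] is non-trivial and [f] keeps it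
   so. *)
have fx0 i : f (x i) != 0%R.
  apply/eqP; rewrite -f1 => /(bij_inj fbij) xi.
  by have := gx i; rewrite -/x xi g1 => /eqP; rewrite eq_sym GRing.oner_eq0.
have fiter k : f (x (iter k (@ordS n) o)) = (f (x o) * c ^+ k)%R.
  by elim: k => [|k IH]; rewrite ?GRing.mulr1 //= fS IH -GRing.mulrA -GRing.exprSr.
(* After [n] shifts the index 0 returns to itself, and the non-zero factor [f (x o)] cancels. *)
have cn : (c ^+ n = 1)%R.
  apply: (GRing.mulfI (fx0 o)); rewrite -fiter GRing.mulr1; congr (f (x _)).
  by apply: val_inj; rewrite val_iter_ordS /= modnn.
have c1 : `|c|%N = 1%N.
  have := congr1 absz cn; rewrite abszX absz1 => /eqP.
  by rewrite -[X in _ == X](exp1n n) eqn_exp2r // => /eqP.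
have [cE|cE] : c = 1%R \/ c = (-1)%R.
- by case: (c) c1 => [[|[|k]]|[|k]] // _; [left|right].
- have fc i : f (x i) = f (x o).
    have -> : i = iter i (@ordS n) o.
      by apply: val_inj; rewrite val_iter_ordS /= add0n modn_small.
    by rewrite fiter cE GRing.expr1n GRing.mulr1.
  (* All generators now share one image, so the relator makes [size w] times a non-zero integer
     vanish. *)
  have := cyclic_ab_relation hpos o fM.
  under eq_bigr => l _ do rewrite fc.
  rewrite big_const_seq count_predT GRing.iter_addr_0 => /eqP.
  by rewrite Num.Theory.mulrn_eq0 (negbTE (fx0 o)) orbF; case: (size w) hlen.
- have : x o * x (ordS o) = 1.
    by apply: (bij_inj fbij); rewrite fM fS cE f1 GRing.mulrN1 GRing.addrN.
  (* Under [g] this reads 1 + 1 = 0 modulo [size w], impossible for a modulus of at least 3. *)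
  move=> /(congr1 g); rewrite gM !gx g1 => /(congr1 val) /=.
  by case: (size w) hlen => [|[|[|k]]].
Qed.
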